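(* Let $p$ be a prime and let $a$ be a positive integer. If $G$ is an Isaacs group of degree $p^a$ that is $p$-closed, then $G$ has a normal Sylow $p$-subgroup $P$ such that $|Z(P)| = p^a$ and $|P:Z(P)| = p^{2a}$, and a Hall $p$-complement $H$ of order $p^a - 1$ such that $Z(P)H$ is a two transitive Frobenius group.
   Context: All groups are finite. For an integer $e > 1$, a group $G$ is an Isaacs group of degree $e$ if $|G| = e^4 - e^3$ and $d = e^2 - e$ is the degree of some irreducible complex character of $G$ (so that $|G| = d(d+e)$). A group is $p$-closed if it has a normal Sylow $p$-subgroup. $Z(P)$ is the center of $P$. A Hall $p$-complement of $G$ is a subgroup of order coprime to $p$ whose index is a power of $p$. For a nontrivial normal subgroup $A$ and a complement $H$, the group $AH$ is a two transitive Frobenius group (with kernel $A$ and complement $H$) if the conjugation action of $H$ on $A \setminus \{1\}$ is transitive and no nonidentity element of $H$ fixes a nonidentity element of $A$. *)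

(* Defs.v *)
From mathcomp Require Import all_boot all_order all_fingroup all_algebra.
From mathcomp Require Import all_solvable all_field all_character.

Set Implicit Arguments.
Unset Strict Implicit.
Unset Printing Implicit Defensive.

Local Open Scope group_scope.

(* The complex irreducible characters are those of MathComp, with values in
   algC; every complex representation of a finite group is realizable over the
   algebraic numbers, so the degrees are the usual ones.  Both differences are
   in nat; the subtraction does not truncate since e > 1. *)
Definition isaacs_group (gT : finGroupType) (e : nat) (G : {group gT}) : Prop :=
  [/\ (1 < e)%N, #|G| = (e ^ 4 - e ^ 3)%N
    & exists i : Iirr G, ('chi_i 1%g = (e ^ 2 - e)%:R)%R].

Definition p_closed (gT : finGroupType) (p : nat) (G : {group gT}) : Prop :=
  exists2 P : {group gT}, p.-Sylow(G) P & P <| G.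

(* [Frobenius K = A ><| H] of frobenius.v is not used because it excludes
   H = 1.  Here H = 1 is allowed, with #|A| = 2: this is the case of the
   extraspecial groups of order 8 (e = 2).  The equation A ><| H = K says that
   A and H are subgroups, H normalizes A, A :&: H = 1 and A * H = K. *)
Definition two_transitive_Frobenius (gT : finGroupType) (K A H : {set gT})
    : Prop :=
  [/\ A ><| H = K, A != 1, [transitive H, on A^# | 'J] & semiregular A H].

(* Main.v *)
(* Write q = p ^ a and let chi have degree d = q(q - 1), so that
   |G| = q^3(q - 1), |P| = q^3 and |G| - d^2 = q^2(q - 1).  A constituent of
   chi_P has degree at least d / |G : P| = q, whence q^2 <= |P : Z(P)| and
   |Z(P)| <= q.  Conversely Z(P) <> 1 is not contained in the kernel of chi,
   otherwise d^2 < |G : Z(P)|; hence d^2 + |G : Z(P)| <= |G| by summing squares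
   of degrees, and |Z(P)| >= q.  Equality means that chi is the only
   irreducible character of G without Z(P) in its kernel; column orthogonality
   then gives |C_G(z)| = q^3, that is C_G(z) = P, for 1 <> z in Z(P).  So a
   complement H of P, of order q - 1, acts regularly on the q - 1 nonidentity
   elements of Z(P). *)

Require Import Defs.
From mathcomp Require Import all_boot all_order all_fingroup all_algebra.
From mathcomp Require Import all_solvable all_field all_character.
From mathcomp Require Import zify ring.

Set Implicit Arguments.
Unset Strict Implicit.
Unset Printing Implicit Defensive.

Import Order.TTheory GRing.Theory Num.Theory.

Local Open Scope group_scope.

(** The irreducible characters with [N] in their kernel are those of [G / N], with the same
    degrees. *)
Lemma irr_sum_square_cfker (gT : finGroupType) (G N : {group gT}) :
    N <| G ->
  (\sum_(j : Iirr G | N \subset cfker 'chi_j) 'chi_j 1%g ^+ 2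
     = #|G : N|%:R :> algC)%R.
Proof.
move=> nNG; rewrite -card_quotient ?normal_norm // -irr_sum_square.
have norm1 (hT : finGroupType) (H : {group hT}) (j : Iirr H) :
    (`|'chi_j 1%g| = 'chi_j 1%g)%R.
  by rewrite ger0_norm // ltW // irr1_gt0.
have := sum_norm_irr_quo (group1 G) nNG.
rewrite morph1; under eq_bigr do rewrite norm1.
by move=> ->; apply: eq_bigr => j _; rewrite norm1.
Qed.

(** In the sum of all squared degrees, the terms missing on the left are positive, so equality means
    that there are none. *)
Lemma irr1_square_cfker_bound (gT : finGroupType) (G N : {group gT})
    (i : Iirr G) :
    N <| G -> ~~ (N \subset cfker 'chi_i)%R ->
  ('chi_i 1%g ^+ 2 + #|G : N|%:R <= #|G|%:R
     ?= iff [forall j : Iirr G, (N \subset cfker 'chi_j) == (j != i)])%R.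
Proof.
move=> nNG kiN.
rewrite -irr_sum_square (bigID (fun j => N \subset cfker 'chi_j)%R) /=.
rewrite -irr_sum_square_cfker // (addrC ('chi_i 1%g ^+ 2)%R).
have sq_gt0 j : (0 < 'chi[G]_j 1%g ^+ 2)%R by rewrite exprn_gt0 ?irr1_gt0.
rewrite [S in (_ <= _ + S ?= iff _)%R](bigD1 i) //= addrA.
split; first by rewrite lerDl sumr_ge0 // => j _; apply: ltW.
rewrite -subr_eq0 opprD addrA subrr sub0r oppr_eq0.
rewrite psumr_eq0 => [|j _]; last exact: ltW.
apply/allP/forallP => [kN j | kN j _].
  have := kN j (mem_index_enum j); rewrite (gt_eqF (sq_gt0 j)).
  have [-> _|] := eqVneq j i; first by rewrite (negPf kiN).
  by rewrite andbT implybF negbK => _ ->.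
by rewrite (eqP (kN j)) negbK; case: eqP.
Qed.

(* The sum of chi_j(1) chi_j(z) over all j is 0, and chi_j(z) = chi_j(1) for
   all j except i, which gives chi_i(z). *)
Lemma card_cent1_irr_unique (gT : finGroupType) (G N : {group gT})
    (i : Iirr G) (z : gT) :
    N <| G -> (forall j : Iirr G, (N \subset cfker 'chi_j)%R = (j != i))
    -> z \in N^# ->
  (#|'C_G[z]|%:R = #|G : N|%:R + (#|G : N|%:R / 'chi_i 1%g) ^+ 2 :> algC)%R.
Proof.
move=> nNG kerN /setD1P[z1 Nz].
have Gz : z \in G := subsetP (normal_sub nNG) z Nz.
have S1 : (\sum_(j : Iirr G | N \subset cfker 'chi_j)
    'chi_j z * ('chi_j 1%g)^* = #|G : N|%:R :> algC)%R.
  rewrite -irr_sum_square_cfker //; apply: eq_bigr => j /subsetP/(_ z Nz) kz.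
  by rewrite cfker1 // conj_natr ?Cnat_irr1.
have := second_orthogonality_relation z (group1 G).
rewrite class1G inE (negPf z1) mulr0n.
rewrite (bigID (fun j => N \subset cfker 'chi_j)%R) /=.
rewrite S1 (big_pred1 i) => [|j]; last by rewrite /= kerN negbK.
rewrite conj_natr ?Cnat_irr1 // => /eqP; rewrite addrC addr_eq0 => /eqP chiz.
have {}chiz : ('chi_i z = - (#|G : N|%:R / 'chi_i 1%g))%R.
  by rewrite -mulNr -chiz mulfK // irr1_neq0.
(* Now the column of [z] with itself: the squares of the [|chi_j(z)|] add up to [#|'C_G[z]|]. *)
have := second_orthogonality_relation z Gz.
rewrite class_refl mulr1n => <-.
rewrite (bigID (fun j => N \subset cfker 'chi_j)%R) /= addrC.
rewrite (big_pred1 i) => [|j]; last by rewrite /= kerN negbK.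
rewrite addrC; congr (_ + _)%R.
  rewrite -irr_sum_square_cfker //; apply: eq_bigr => j /subsetP/(_ z Nz) kz.
  by rewrite cfker1 // conj_natr ?Cnat_irr1.
by rewrite -normCK chiz normrN ger0_norm // divr_ge0 ?ler0n // ltW ?irr1_gt0.
Qed.

(** The trivial character also has [N] in its kernel; its square makes the bound strict. *)
Lemma irr1_square_lt_index (gT : finGroupType) (G N : {group gT})
    (i : Iirr G) :
    N <| G -> (N \subset cfker 'chi_i)%R -> i != 0%R ->
  ('chi_i 1%g ^+ 2 < #|G : N|%:R)%R.
Proof.
move=> nNG kiN i0; rewrite -irr_sum_square_cfker //.
rewrite (bigD1 i) //= (bigD1 0%R) /=; last first.
  by rewrite eq_sym i0 irr0 cfker_cfun1 normal_sub.
rewrite ltrDl ltr_wpDr //.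
  by rewrite sumr_ge0 // => j _; rewrite exprn_ge0 // ltW ?irr1_gt0.
by rewrite exprn_gt0 ?irr1_gt0.
Qed.

(** Frobenius reciprocity: if ['chi_j] is a constituent of the restriction to [P], then ['chi_i] is
    one of the character induced from ['chi_j]. *)
Lemma irr1_le_index_constituent (gT : finGroupType) (G P : {group gT})
    (i : Iirr G) :
  P \subset G ->
  exists j : Iirr P, ('chi_i 1%g <= #|G : P|%:R * 'chi_j 1%g :> algC)%R.
Proof.
move=> sPG; have [j] := constt_cfRes_irr P i.
rewrite -constt_Ind_Res => /char1_ge_constt.
by rewrite cfInd_char ?irr_char // cfInd1 // => /(_ isT); exists j.
Qed.

(** ['Z(P)] acts by scalars, so it lies in ['Z('chi_i)], whose index bounds the squared degree. *)
Lemma irr1_square_le_index_center (gT : finGroupType) (P : {group gT})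
    (i : Iirr P) :
  ('chi_i 1%g ^+ 2 <= #|P : 'Z(P)|%:R :> algC)%R.
Proof.
have sZ : ('Z(P)%g \subset 'Z('chi_i)%CF)%R.
  by rewrite -cap_cfcenter_irr bigcap_inf.
by apply: le_trans (irr1_bound i) _; rewrite ler_nat dvdn_leq ?indexgS.
Qed.

Theorem theorem2 (gT : finGroupType) (G : {group gT}) (p a : nat)
    (p_prime : prime p) (a_gt0 : (0 < a)%N)
    (isaacsG : isaacs_group (p ^ a)%N G) (p_closedG : p_closed p G) :
  exists P H : {group gT},
    [/\ p.-Sylow(G) P /\ P <| G,
        #|'Z(P)| = (p ^ a)%N,
        #|P : 'Z(P)| = (p ^ (2 * a))%N,
        p^'.-Hall(G) H /\ #|H| = (p ^ a - 1)%N
      & two_transitive_Frobenius ('Z(P) * H) 'Z(P) H].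
Proof.
have [q_gt1 oG [i chi1]] := isaacsG; have [P sylP nPG] := p_closedG.
have sPG := normal_sub nPG; have pP := pHall_pgroup sylP.
(* Writing [q = r.+1] keeps truncated subtraction out of the nonlinear arithmetic. *)
have [r Dq] : exists r, (p ^ a)%N = r.+1 by exists (p ^ a).-1; lia.
have r_gt0 : (0 < r)%N by lia.
have q_gt0 : (0 < p ^ a)%N by lia.
have {}oG : #|G| = ((p ^ a) ^ 3 * r)%N by rewrite oG Dq; nia.
have {}chi1 : ('chi_i 1%g = ((p ^ a) * r)%:R)%R.
  by rewrite chi1; congr (_%:R)%R; rewrite Dq; nia.
(* [r] and [q] are consecutive, so the [p]-part of [#|G|] is [q^3]. *)
have co_pr : coprime p r.
  by rewrite -(coprime_pexpl _ _ a_gt0) Dq coprimeSn.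
have oP : #|P| = ((p ^ a) ^ 3)%N.
  rewrite (card_Hall sylP) oG partnM ?(expn_gt0 _ 3) ?q_gt0 //.
  rewrite -expnM part_pnat_id ?pnatX ?pnat_id // part_p'nat ?muln1 //.
  by rewrite p'natE // -prime_coprime.
have indP : #|G : P| = r.
  by rewrite -divgS // oG oP mulKn // expn_gt0 q_gt0.
set Z := 'Z(P)%G.
have nZG : Z <| G := char_normal_trans (center_char P) nPG.
have Z_neq1 : 'Z(P) != 1.
  rewrite center_nil_eq1 ?(pgroup_nil pP) // -cardG_gt1 oP.
  by rewrite Dq; nia.
have LZ := Lagrange (center_sub P); have LZG := Lagrange (normal_sub nZG).
have Zle : (#|'Z(P)| <= p ^ a)%N.
  have [j] := irr1_le_index_constituent i sPG.
  rewrite indP chi1 natrM mulrC ler_pM2l ?ltr0n // => le_q.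
  have := le_trans _ (irr1_square_le_index_center j).
  move=> /(_ ((p ^ a)%:R ^+ 2))%R; rewrite lerXn2r ?nnegrE ?ler0n //;
    last by rewrite ltW ?irr1_gt0.
  move=> /(_ isT); rewrite -natrX ler_nat => leZ.
  have : (#|'Z(P)| * (p ^ a) ^ 2 <= p ^ a * (p ^ a) ^ 2)%N.
    by rewrite -expnS -oP -LZ leq_mul2l leZ orbT.
  by rewrite leq_pmul2r // expn_gt0 q_gt0.
have i_neq0 : (i != 0)%R.
  apply/eqP => i0; move/eqP: chi1; rewrite i0 irr0 cfun11 (eqr_nat _ 1) Dq.
  by case: eqP => //; nia.
have kiZ : ~~ (Z \subset cfker 'chi_i)%R.
  apply/negP => /(irr1_square_lt_index nZG)/(_ i_neq0).
  rewrite chi1 -natrX ltr_nat => lt_d.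
  (* As [#|'Z(P)| >= 2], [d^2 < #|G : Z|] gives [2 d^2 < #|G|]; the next bound, in essence
     [r.+1 <= 2 * r], contradicts this. *)
  have : (1 < #|'Z(P)|)%N by rewrite cardG_gt1.
  have : (r.+1 ^ 3 * r <= 2 * (r.+1 * r) ^ 2)%N.
    have -> : (r.+1 ^ 3 * r = r.+1 ^ 2 * r * r.+1)%N by ring.
    have -> : (2 * (r.+1 * r) ^ 2 = r.+1 ^ 2 * r * (2 * r))%N by ring.
    by rewrite leq_mul2l; lia.
  move: LZG lt_d; rewrite oG Dq /Z /=.
  move: #|G : _| #|'Z(P)| (_ ^ 3 * r)%N ((_ * r) ^ 2)%N => I m x y; nia.
have bnd := irr1_square_cfker_bound nZG kiZ.
have oZ : #|'Z(P)| = (p ^ a)%N.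
  apply/eqP; rewrite eqn_leq Zle /=.
  have := bnd.1; rewrite chi1 -natrX -natrD ler_nat oG => leG.
  have DG : ((p ^ a) ^ 3 * r = p ^ a * ((p ^ a) ^ 2 * r))%N by ring.
  have leI : (#|G : Z| <= (p ^ a) ^ 2 * r)%N.
    by rewrite -(leq_add2l ((p ^ a * r) ^ 2)) (leq_trans leG) // Dq; lia.
  have K_gt0 : (0 < (p ^ a) ^ 2 * r)%N by rewrite muln_gt0 expn_gt0 q_gt0.
  rewrite -(leq_pmul2r K_gt0).
  by rewrite -DG -oG -LZG leq_mul2l leI orbT.
have indZG : #|G : Z| = ((p ^ a) ^ 2 * r)%N.
  by apply/eqP; rewrite -(eqn_pmul2l q_gt0) -{1}oZ LZG oG; apply/eqP; ring.
have kerZ (j : Iirr G) : (Z \subset cfker 'chi_j)%R = (j != i).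
  have := bnd.2; rewrite indZG oG chi1 -natrX -natrD eqr_nat.
  (* The bound is attained: [(q r)^2 + q^2 r = q^3 r]. *)
  rewrite [X in X = _](_ : _ = true); last by rewrite Dq; lia.
  by move=> /esym/forallP/(_ j)/eqP.
have cardC z : z \in 'Z(P)^# -> 'C_G[z] = P.
  move=> Zz; apply/esym/eqP; rewrite eqEcard subsetI sPG.
  have /setD1P[_ /setIP[_ cPz]] := Zz.
  rewrite sub_cent1 cPz /=.
  (* The quotient in the formula is [q], so the order is [q^2 r + q^2 = q^3]. *)
  have := card_cent1_irr_unique nZG kerZ Zz.
  have -> : (#|G : Z|%:R / 'chi_i 1%g = (p ^ a)%:R :> algC)%R.
    apply: (canLR (mulfK (irr1_neq0 i))).
    by rewrite chi1 -natrM indZG; congr (_%:R)%R; ring.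
  rewrite indZG -natrX -natrD oP => /eqP; rewrite eqr_nat => /eqP ->.
  by rewrite Dq; lia.
have [H /complP[tiPH defG]] :=
  splitsP (SchurZassenhaus_split (pHall_Hall sylP) nPG).
have sHG : H \subset G by rewrite -defG mulG_subr.
have oH : #|H| = r.
  apply/eqP; rewrite -(eqn_pmul2l (cardG_gt0 P)) -TI_cardMg // defG.
  by rewrite -indP Lagrange.
have semiHZ : semiregular H 'Z(P).
  (* ['C_H[z] = H :&: 'C_G[z] = H :&: P = 1]. *)
  move=> z /cardC defP; apply/trivgP.
  by rewrite -tiPH -defP -setIA (setIC 'C[z]) setIA (setIidPr sHG).
have tiZH : 'Z(P) :&: H = 1.
  by apply/trivgP; rewrite -tiPH setSI ?center_sub.
have nZH : H \subset 'N('Z(P)) := subset_trans sHG (normal_norm nZG).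
have Dr : r = (p ^ a - 1)%N by lia.
exists P, H; split=> //.
- apply/eqP; rewrite -(eqn_pmul2l q_gt0) -{1}oZ LZ oP -expnM -expnD.
  by apply/eqP; congr (_ ^ _)%N; lia.
- split; last by rewrite oH.
  rewrite /pHall sHG /pgroup oH -divgS // oG oH mulnK // -oP pnatNK.
  by rewrite [p.-nat _]pP p'natE // -prime_coprime // co_pr.
split=> //; [by rewrite sdprodE | | exact: semiregular_sym].
have [z Z1z] : exists z, z \in 'Z(P)^#.
  by apply/set0Pn; rewrite -subset0 subDset setU0 subG1.
(* The orbit of [z] lies in ['Z(P)^#], and both have [r] elements since the stabilizer is
   trivial. *)
apply/imsetP; exists z => //; apply/esym/eqP; rewrite eqEcard.
apply/andP; split.
  by rewrite acts_sub_orbit // astabsJ normD1.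
rewrite card_orbit astab1J (semiHZ z Z1z) indexg1 oH.
by have := oZ; rewrite (cardsD1 1) group1 Dq add1n => -[->].
Qed.
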